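(* Let $R$ be a field, let $V$ be a vector space over $R$ of finite dimension $n\ge 2$, and let $\mathcal{X}$ be a finite subset of the projective space $\mathcal{P}(V)$ containing more than one element. Suppose that every permutation of $\mathcal{X}$ can be extended to an element of $\mathrm{PGL}(V)$. Then one of the following possibilities is realized: (1) $\mathcal{X}$ is an independent subset; (2) $\mathcal{X}$ is an $m$-simplex for some $m\in\{2,\dots,n\}$; (3) the characteristic of $R$ is equal to $3$ and $\mathcal{X}$ is a harmonic subset.
   Context: $\mathcal{P}(V)$ is the set of $1$-dimensional subspaces of $V$. $\mathrm{PGL}(V)$ is the group of transformations of $\mathcal{P}(V)$ induced by linear automorphisms of $V$. A permutation $s$ of $\mathcal{X}\subset\mathcal{P}(V)$ extends to an element of $\mathrm{PGL}(V)$ if there is $f\in\mathrm{PGL}(V)$ with $f(P)=s(P)$ for all $P\in\mathcal{X}$. Distinct elements $P_{1},\dots,P_{m}\in\mathcal{P}(V)$ form an independent subset if non-zero vectors $x_{1}\in P_{1},\dots,x_{m}\in P_{m}$ are linearly independent. For $m\in\{2,\dots,n\}$, an $(m+1)$-element subset of $\mathcal{P}(V)$ is called an $m$-simplex if it is not independent and every $m$-element subset of it is independent. A subset $\mathcal{X}\subset\mathcal{P}(V)$ is called harmonic if there are linearly independent vectors $x,y\in V$ such that $\mathcal{X}=\{\langle x\rangle,\langle y\rangle,\langle x+y\rangle,\langle x-y\rangle\}$, where $\langle\cdot\rangle$ denotes linear span. *)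

(* Defs.v *)
From HB Require Import structures.
From mathcomp Require Import all_boot all_order all_algebra all_fingroup.
From mathcomp Require Import finmap.

Set Implicit Arguments.
Unset Strict Implicit.
Unset Printing Implicit Defensive.

Import GRing.Theory.
Local Open Scope ring_scope.
Local Open Scope fset_scope.

Section ProjectiveSpace.
Variables (R : fieldType) (V : vectType R).

Record projSpace := ProjPoint {
  point_space :> {vspace V};
  _ : \dim point_space == 1%N }.

HB.instance Definition _ := [isSub for point_space].
HB.instance Definition _ := [Choice of projSpace by <:].

Definition isPGL (f : projSpace -> projSpace) : Prop :=
  exists2 g : 'End(V), bijective g &
    forall P : projSpace, f P = (g @: P)%VS :> {vspace V}.

Definition extendsToPGL (X : {fset projSpace}) (s : {perm X}) : Prop :=
  exists2 f : projSpace -> projSpace, isPGL f &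
    forall P : X, f (val P) = val (s P).

(* The representatives are chosen by a function on the whole projective space,
   constrained only on X; the empty set is independent. *)
Definition independent (X : {fset projSpace}) : Prop :=
  forall x : projSpace -> V,
    (forall P, P \in X -> x P \in (P : {vspace V}) /\ x P != 0) ->
    free [seq x P | P <- enum_fset X].

Definition simplex (m : nat) (X : {fset projSpace}) : Prop :=
  [/\ #|` X| = m.+1,
      ~ independent X
    & forall Y : {fset projSpace}, Y `<=` X -> #|` Y| = m -> independent Y].

(* The equality is between sets of subspaces of V, so that no proof that the
   four spans are lines is needed. *)
Definition harmonic (X : {fset projSpace}) : Prop :=
  exists x y : V,
    free [:: x; y] /\
    [fset point_space P | P in X] =
      [fset <[x]>%VS; <[y]>%VS; <[x + y]>%VS; <[x - y]>%VS].

End ProjectiveSpace.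

(* Main.v *)
Require Import Defs.
From mathcomp Require Import all_boot all_order all_algebra all_fingroup.
From mathcomp Require Import finmap.
From mathcomp Require Import ring.

Set Implicit Arguments.
Unset Strict Implicit.
Unset Printing Implicit Defensive.

Import GRing.Theory.
Local Open Scope ring_scope.

(** Symmetry makes the independence of a subset of X depend only on its
    cardinality. If m + 1 is the least cardinality of a dependent subset, then X
    is an m-simplex if it has exactly m + 1 points. With two more points j, k
    than a basis, the projective map exchanging two basis points and fixing all
    other points yields relations between the coordinates of j and k: for
    m > 2 they put j, k and m - 2 basis points in a dependent set of size m; for
    m = 2 they say that the cross-ratio is -1. This determines the fourth point
    from the first three, and since the cross-ratio stays -1 under every
    permutation of the points, 3 = 0. *)

(** A permutation [p] for the tails is corrected by the transposition of [p a] and [b]; neither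
    point lies in [t], so the images already placed stay fixed. *)
Lemma perm_map_uniq (T : finType) (s t : seq T) :
  uniq s -> uniq t -> size s = size t -> exists p : {perm T}, map p s = t.
Proof.
elim: s t => [|a s IHs] [|b t] //=; first by exists 1%g.
move=> /andP[a_s s_uniq] /andP[b_t t_uniq] [size_st].
have [p p_st] := IHs t s_uniq t_uniq size_st.
exists (p * tperm (p a) b)%g; rewrite permM tpermL; congr (_ :: _).
rewrite -[RHS]p_st; apply/eq_in_map => i i_s; rewrite permM tpermD //.
  by apply: contraNneq a_s => /perm_inj->.
by apply: contraNneq b_t => ->; rewrite -p_st map_f.
Qed.

(** * Coordinates in a free family *)

Section FreeCoordinates.
Variables (R : fieldType) (V : vectType R).

Lemma free_dim (s : seq V) : free s = (\dim (\sum_(v <- s) <[v]>) == size s).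
Proof. by rewrite -span_def. Qed.

Lemma free2_eq0 (u v : V) (a b : R) :
  free [:: u; v] -> a *: u + b *: v = 0 -> a = 0 /\ b = 0.
Proof.
move=> uv_free eq0.
have coordE k : (\sum_(i < 2) [tuple a; b]`_i *: [tuple u; v]`_i) = 0 ->
  [tuple a; b]`_(k : 'I_2) = 0.
  by move=> /(congr1 (coord [tuple u; v] k)); rewrite coord_sum_free // linear0.
by split; [apply: (coordE 0) | apply: (coordE 1)];
  rewrite !big_ord_recl big_ord0 addr0.
Qed.

(** Since [g] permutes the vectors of [B] up to scalars, only the [l]-th term of [v] contributes to
    the coordinate of [g v] at [p l]. *)
Lemma coord_monomial (m : nat) (B : m.-tuple V) (g : 'End(V))
    (p : {perm 'I_m}) (c : 'I_m -> R) (v : V) (e : R) (l : 'I_m) :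
    free B -> (forall k : 'I_m, g B`_k = c k *: B`_(p k)) ->
    v \in <<B>>%VS -> g v = e *: v ->
  coord B l v * c l = e * coord B (p l) v.
Proof.
move=> B_free gB v_B gv.
rewrite -[e * _]linearZ -gv [in RHS](coord_span v_B) !linear_sum /=.
rewrite (bigD1 l) //= big1 => [|k k_l].
  by rewrite !linearZ /= gB linearZ /= coord_free // eqxx mulr1 addr0.
rewrite !linearZ /= gB linearZ /= coord_free //.
by rewrite (inj_eq perm_inj) (negPf k_l) !mulr0.
Qed.

End FreeCoordinates.

(** * Families of vectors whose lines are permuted arbitrarily by linear automorphisms *)

Section HomogeneousFamily.
Variables (R : fieldType) (V : vectType R) (T : finType) (x : T -> V).
Hypothesis x_hom : forall p : {perm T}, exists2 g : 'End(V), lker g == 0%VS &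
  forall i, (g @: <[x i]>)%VS = <[x (p i)]>%VS.
Hypothesis x_neq0 : forall i, x i != 0.

(** A permutation carrying [s] to [t] is induced on the lines by an injective linear map, which
    preserves the dimension of a sum of lines. *)
Lemma free_uniq_size (s t : seq T) :
  uniq s -> uniq t -> size s = size t -> free (map x s) -> free (map x t).
Proof.
move=> s_uniq t_uniq size_st.
have [p <-] := perm_map_uniq s_uniq t_uniq size_st.
have [g /eqP g0 gx] := x_hom p.
rewrite !free_dim !big_map !size_map => /eqP <-.
under eq_bigr do rewrite -gx.
by rewrite -limg_sum limg_dim_eq // g0 capv0.
Qed.

Lemma monomial_of_perm (p : {perm T}) :
  exists g : 'End(V), exists2 c : T -> R,
    forall i, c i != 0 & forall i, g (x i) = c i *: x (p i).
Proof.
have [g /lker0P g_inj gx] := x_hom p.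
have /fin_all_exists[c gE] i : exists c, g (x i) = c *: x (p i).
  by apply/vlineP; rewrite -gx memv_img ?memv_line.
exists g, c => // i; apply: contraNneq (x_neq0 i) => c0.
by apply/eqP/g_inj; rewrite linear0 gE c0 scale0r.
Qed.

(** If the coordinate vanished, [x j] would lie in the span of the other vectors of [s]. *)
Lemma coord_rem_neq0 (s : seq T) (j : T) (l : 'I_(size (map x s))) :
    uniq s -> free (map x (j :: rem (nth j s l) s)) ->
    x j \in <<map x s>>%VS ->
  coord (in_tuple (map x s)) l (x j) != 0.
Proof.
move=> s_uniq; rewrite /= free_cons => /andP[x_j _] j_s.
apply: contraNneq x_j => coord0.
rewrite (coord_span (X := in_tuple (map x s)) j_s) (bigD1 l) //= coord0.
rewrite scale0r add0r memv_suml // => k k_l; rewrite memvZ // memv_span //.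
have k_lt : (k < size s)%N by rewrite -(size_map x).
have l_lt : (l < size s)%N by rewrite -(size_map x).
rewrite (nth_map j) // map_f // mem_rem_uniq // inE mem_nth // andbT.
by rewrite nth_uniq.
Qed.

Lemma coord_drop2 (a b : V) (t : seq V) (v : V)
    (B := in_tuple [:: a, b & t]) :
    v \in <<B>>%VS ->
    coord B ord0 v = 0 -> coord B (lift ord0 ord0) v = 0 ->
  v \in <<t>>%VS.
Proof.
move=> v_B c0 c1; rewrite (coord_span v_B) !big_ord_recl c0 c1 !scale0r !add0r.
apply: memv_suml => k _; apply: memvZ; apply: memv_span.
exact: (mem_nth 0 (ltn_ord k)).
Qed.

(* Exchanging two basis points while fixing a third one and the two extra
   points j, k forces x j and x k to have proportional coordinates at the
   exchanged points. *)
Lemma no_two_extra_points (m : nat) : (2 < m)%N ->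
    (forall s, uniq s -> size s = m -> free (map x s)) ->
    (forall s, uniq s -> size s = m.+1 -> ~~ free (map x s)) ->
  (#|T| <= m.+1)%N.
Proof.
move=> m_gt2 m_free m1_dep; rewrite leqNgt; apply/negP => T_gt.
(* The points of [s] below serve as a basis, and [j], [k] are the extra points. The third basis
   point [c] exists because [m > 2]. *)
have [j [k [a [b [c [t [size_t jkabct_uniq]]]]]]] :
    exists (j k a b c : T) (t : seq T),
    size [:: a, b, c & t] = m /\ uniq [:: j, k, a, b, c & t].
  have: size (take m.+2 (enum T)) = m.+2 by rewrite size_takel // -cardE.
  have: uniq (take m.+2 (enum T)) by rewrite take_uniq ?enum_uniq.
  case: (take _ _) => [|j [|k [|a [|b [|c t]]]]] //= uniq_s [size_s];
    try by rewrite -size_s in m_gt2.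
  by exists j, k, a, b, c, t.
pose s := [:: a, b, c & t].
have size_s : size s = m by [].
have: uniq [:: j, k & s] by [].
rewrite 2!cons_uniq inE negb_or => /and3P[/andP[j_k j_s] k_s s_uniq].
have s_free : free (map x s) by apply: m_free.
have in_span i : i \notin s -> x i \in <<map x s>>%VS.
  move=> i_s; have := m1_dep (i :: s).
  rewrite cons_uniq i_s s_uniq => /(_ isT (congr1 S size_s)).
  by rewrite map_cons free_cons s_free andbT negbK.
pose B := in_tuple (map x s).
(* Replacing any basis point by [i] gives [m] distinct points again, hence a free family. *)
have coord_neq0 i l : i \notin s -> coord B l (x i) != 0.
  move=> i_s; apply: coord_rem_neq0 => //; last exact: in_span.
  have l_lt : (l < size s)%N by rewrite -(size_map x).
  apply: m_free; last first.
    transitivity (size (rem (nth i s l) s)).+1 => //.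
    by rewrite size_rem ?mem_nth // size_s prednK // (leq_ltn_trans _ m_gt2).
  by rewrite cons_uniq rem_uniq // andbT mem_rem_uniq // inE (negPf i_s) andbF.
have [a_b a_c b_c] : [/\ a != b, a != c & b != c].
  move: s_uniq; rewrite /= !inE !negb_or.
  by case/and4P=> /and3P[-> ->] _ /andP[->].
have [g [d d_neq0 gE]] := monomial_of_perm (tperm a b).
pose l0 : 'I_(size (map x s)) := ord0.
pose l1 : 'I_(size (map x s)) := lift ord0 ord0.
pose l2 : 'I_(size (map x s)) := lift ord0 (lift ord0 ord0).
have gB (l : 'I_(size (map x s))) :
    g B`_l = d (nth a s l) *: B`_(tperm l0 l1 l).
  have nthB (l' : 'I_(size (map x s))) : B`_l' = x (nth a s l').
    by rewrite (nth_map a) // -(size_map x).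
  rewrite !nthB gE; congr (_ *: x _).
  case: (tpermP l0 l1 l) => [->|->|/eqP l_l0 /eqP l_l1];
    rewrite ?tpermL ?tpermR //.
  have l_lt : (l < size s)%N by rewrite -(size_map x).
  by rewrite tpermD //;
    [rewrite -[a]/(nth a s 0) | rewrite -[b]/(nth a s 1)];
    rewrite nth_uniq // eq_sym.
have coordg i l : i \notin s ->
    coord B l (x i) * d (nth a s l) = d i * coord B (tperm l0 l1 l) (x i).
  move=> i_s.
  apply: (coord_monomial (g := g) (c := fun l => d (nth a s l))) => //.
    exact: in_span.
  by rewrite gE tpermD //; apply: contraNneq i_s => <-; rewrite !inE eqxx ?orbT.
(* The basis point [c] is fixed by the exchange, so its coordinate forces every extra vector to have
   the eigenvalue [d c]. *)
have d_c i : i \notin s -> d i = d c.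
  move=> i_s; have := coordg i l2 i_s; rewrite tpermD // mulrC => /mulIf->//.
  exact: coord_neq0.
have prop :
    coord B l0 (x j) * coord B l1 (x k) = coord B l0 (x k) * coord B l1 (x j).
  apply: (mulfI (d_neq0 a)); apply: (mulfI (d_neq0 c)).
  have := coordg j l0 j_s; have := coordg k l0 k_s.
  rewrite tpermL (d_c _ j_s) (d_c _ k_s) /= => Ek Ej.
  transitivity ((coord B l0 (x j) * d a) * (d c * coord B l1 (x k))).
    by ring.
  by rewrite Ej -Ek; ring.
(* This combination has zero coordinates at both [a] and [b], so it lies in the span of the other
   [m - 2] basis vectors. *)
have z_t :
    coord B l0 (x j) *: x k - coord B l0 (x k) *: x j \in <<map x (c :: t)>>%VS.
  apply: (@coord_drop2 (x a) (x b)).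
  - by apply: rpredB; apply: rpredZ; apply: in_span.
  - by rewrite linearB !linearZ /= -/l0 mulrC subrr.
  - by rewrite linearB !linearZ /= -/l1 prop subrr.
have: free (map x [:: j, k, c & t]).
  apply: m_free => //; apply: subseq_uniq jkabct_uniq.
  exact: (cat_subseq (subseq_refl [:: j; k]) (suffix_subseq [:: a; b] _)).
rewrite map_cons free_cons => /andP[/negP x_j _]; apply: x_j.
have := coord_neq0 k l0 k_s; set r := coord B l0 (x k) in z_t * => r_neq0.
have : r *: x j \in <<map x [:: k, c & t]>>%VS.
  rewrite -(subKr (coord B l0 (x j) *: x k) (r *: x j)) map_cons span_cons.
  rewrite memvB //; last by rewrite (subvP (addvSr _ _)).
  by rewrite (subvP (addvSl _ _)) // memvZ ?memv_line.
by rewrite rpredZeq (negPf r_neq0).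
Qed.

(** The conclusion says that the cross-ratio is -1. Exchanging the lines of [x i] and [x j] while
    fixing those of [x k] and [x l] gives equal squares of [a' * b] and [a * b']; these products
    differ because the lines of [x k] and [x l] do, so they are opposite. *)
Lemma exchange_coords (i j k l : T) (a b a' b' : R) :
    uniq [:: i; j; k; l] -> (forall p q, p != q -> free [:: x p; x q]) ->
    x k = a *: x i + b *: x j -> x l = a' *: x i + b' *: x j ->
  a' * b + a * b' = 0.
Proof.
rewrite /= !inE !negb_or => /and4P[/and3P[i_j i_k i_l] /andP[j_k j_l] k_l _].
move=> x_free x_k x_l.
have [g [d d_neq0 gE]] := monomial_of_perm (tperm i j).
have coordg h p q : i != h -> j != h -> x h = p *: x i + q *: x j ->
    p * d i = d h * q /\ q * d j = d h * p.
  move=> i_h j_h x_h; have := gE h.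
  rewrite tpermD // [in LHS]x_h linearD !linearZ /=.
  rewrite !gE tpermL tpermR x_h => E.
  have /(free2_eq0 (x_free _ _ i_j))[] :
      (d h * p - q * d j) *: x i + (d h * q - p * d i) *: x j = 0.
    rewrite !scalerBl -!scalerA addrACA -scalerDr -E.
    by rewrite -opprD [X in _ - X]addrC subrr.
  by move=> /eqP; rewrite subr_eq0 => /eqP-> /eqP; rewrite subr_eq0 => /eqP->.
have [ak bk] := coordg k a b i_k j_k x_k.
have [al bl] := coordg l a' b' i_l j_l x_l.
have E1 : d l * (a * b') = d k * (a' * b).
  apply: (mulfI (d_neq0 i)).
  transitivity (a * d i * (d l * b')); first by ring.
  by rewrite ak -al; ring.
have E2 : d l * (a' * b) = d k * (a * b').
  apply: (mulfI (d_neq0 j)).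
  transitivity (b * d j * (d l * a')); first by ring.
  by rewrite bk -bl; ring.
have det_neq0 : a' * b - a * b' != 0.
  apply/eqP => det0.
  have : (b *: x l - b' *: x k) = (a' * b - a * b') *: x i.
    rewrite x_k x_l !scalerDr !scalerA opprD addrACA -!scalerBl.
    by rewrite (mulrC b) (mulrC b') (mulrC b b') subrr scale0r addr0.
  rewrite det0 scale0r -scaleNr => /(free2_eq0 (x_free l k _))[|b0 _].
    by rewrite eq_sym.
  move: (x_free _ _ i_k); rewrite x_k b0 scale0r addr0.
  have /(free2_eq0 (x_free _ _ i_k))[_ /eqP] : (- a) *: x i + 1 *: x k = 0.
    by rewrite x_k b0 scale0r addr0 scaleNr scale1r addNr.
  by rewrite oner_eq0.
apply: (mulfI det_neq0); apply: (mulfI (d_neq0 k)); rewrite !mulr0.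
transitivity (d k * (a' * b) * (a' * b) - d k * (a * b') * (a * b')).
  by ring.
by rewrite -E1 -E2; ring.
Qed.

Lemma harmonic_of_extra_points :
    (forall i j, i != j -> free [:: x i; x j]) ->
    (forall s, uniq s -> size s = 3 -> ~~ free (map x s)) ->
    (3 < #|T|)%N ->
  3%:R = 0 :> R /\ exists i j k l (u v : V),
    [/\ free [:: u; v], forall t, [\/ t = i, t = j, t = k | t = l]
      & map (fun t => <[x t]>%VS) [:: i; j; k; l] =
        [:: <[u]>; <[v]>; <[u + v]>; <[u - v]>]%VS].
Proof.
move=> x_free x3_dep T_gt.
have [i [j [k [l ijkl_uniq]]]] : exists i j k l : T, uniq [:: i; j; k; l].
  have: size (take 4 (enum T)) = 4 by rewrite size_takel // -cardE.
  have: uniq (take 4 (enum T)) by rewrite take_uniq ?enum_uniq.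
  case: (take _ _) => [|i [|j [|k [|l []]]]] // ijkl_uniq _.
  by exists i, j, k, l.
have := ijkl_uniq; rewrite /= !inE !negb_or.
case/and4P=> /and3P[i_j i_k i_l] /andP[j_k j_l] k_l _.
(* A zero coefficient would make [x p] proportional to [x i] or [x j]. *)
have coords p : i != p -> j != p -> exists a b,
    [/\ x p = a *: x i + b *: x j, a != 0 & b != 0].
  move=> i_p j_p; have := x3_dep [:: p; i; j].
  rewrite /= !inE !negb_or i_j ![p == _]eq_sym i_p j_p => /(_ isT erefl).
  rewrite free_cons x_free // andbT negbK span_cons span_seq1.
  case/memv_addP=> _ /vlineP[a ->] [_ /vlineP[b ->] x_p].
  exists a, b; split=> //.
    apply/eqP => a0; have /(free2_eq0 (x_free _ _ j_p))[_ /eqP] :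
        - b *: x j + 1 *: x p = 0.
      by rewrite x_p a0 scale0r add0r scaleNr scale1r addNr.
    by rewrite oner_eq0.
  apply/eqP => b0; have /(free2_eq0 (x_free _ _ i_p))[_ /eqP] :
      - a *: x i + 1 *: x p = 0.
    by rewrite x_p b0 scale0r addr0 scaleNr scale1r addNr.
  by rewrite oner_eq0.
have [a [b [x_k a_neq0 b_neq0]]] := coords k i_k j_k.
have [a' [b' [x_l a'_neq0 b'_neq0]]] := coords l i_l j_l.
have rel := exchange_coords ijkl_uniq x_free x_k x_l.
have b'E : b' = - (a' * b / a).
  by apply: (mulfI a_neq0); rewrite -[LHS](addKr (a' * b)) rel; field.
split.
  (* Coordinates in the basis [x i], [x k] allow the harmonic relation to be applied with [j] and
     [k] interchanged; it then reads [3 * (a' / b) = 0]. *)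
  have x_j : x j = - (a / b) *: x i + b^-1 *: x k.
    rewrite x_k scalerDr !scalerA mulVf // scale1r addrA -scalerDl.
    by rewrite [_ * a]mulrC addNr scale0r add0r.
  have x_l' : x l = (2 * a') *: x i + (- (a' / a)) *: x k.
    rewrite x_l x_k scalerDr !scalerA addrA -scalerDl b'E.
    congr (_ *: _ + _ *: _).
      by field.
    by field.
  have ikjl_uniq : uniq [:: i; k; j; l].
    rewrite (perm_uniq (_ : perm_eq _ [:: i; j; k; l])) //.
    by rewrite perm_cons (perm_catCA [:: k] [:: j]).
  have := exchange_coords ikjl_uniq x_free x_j x_l'.
  have -> : 2 * a' * b^-1 + - (a / b) * - (a' / a) = 3%:R * (a' / b).
    by field; apply/andP.
  move/eqP; rewrite mulf_eq0 mulf_eq0 invr_eq0.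
  by rewrite (negPf a'_neq0) (negPf b_neq0) !orbF => /eqP.
have vlineZ (c : R) (w : V) : c != 0 -> (<[c *: w]> = <[w]>)%VS.
  move=> c_neq0; apply/eqP; rewrite eqEsubv -!memvE memvZ ?memv_line //=.
  by rewrite -[X in X \in _](scalerK c_neq0) memvZ ?memv_line.
(* With this scaling [x k] is the sum of the two basis vectors, and [rel] makes [x l] a multiple of
   their difference. *)
exists i, j, k, l, (a *: x i), (b *: x j); split.
- by have := x_free i j i_j; rewrite !free_dim !big_cons !vlineZ.
- move=> t; have [|i_t] := eqVneq i t; first by constructor.
  have [|j_t] := eqVneq j t; first by constructor.
  have [|k_t] := eqVneq k t; first by constructor.
  have [|l_t] := eqVneq l t; first by constructor.
  (* A fifth point [t] would satisfy the same relation as [l], which fixes the ratio of its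
     coordinates and makes [x t] proportional to [x l]. *)
  have [c [c' [x_t c_neq0 c'_neq0]]] := coords t i_t j_t.
  have ijkt_uniq : uniq [:: i; j; k; t].
    by rewrite /= !inE !negb_or i_j i_k i_t j_k j_t k_t.
  have relt := exchange_coords ijkt_uniq x_free x_k x_t.
  have /(free2_eq0 (x_free _ _ l_t))[/eqP] : c *: x l + (- a') *: x t = 0.
    rewrite x_l x_t !scalerDr !scalerA addrACA -!scalerDl.
    have -> : c * a' + - a' * c = 0 by ring.
    have -> : c * b' + - a' * c' = 0.
      apply: (mulfI a_neq0).
      transitivity (c * (a' * b + a * b') - a' * (c * b + a * c')).
        by ring.
      by rewrite rel relt !mulr0 subrr.
    by rewrite !scale0r addr0.
  by rewrite (negPf c_neq0).
- rewrite /= !vlineZ // -x_k; congr [:: _; _; _; _].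
  have -> : x l = (a' / a) *: (a *: x i - b *: x j).
    by rewrite x_l b'E scalerBr !scalerA divfK // -scaleNr mulrAC.
  by rewrite vlineZ // mulf_neq0 ?invr_eq0.
Qed.

End HomogeneousFamily.

(** * From projective points to representative vectors *)

Local Open Scope fset_scope.

Lemma in_fset4 (K : choiceType) (a b c d z : K) :
  (z \in [fset a; b; c; d]) = [|| z == a, z == b, z == c | z == d].
Proof. by rewrite !in_fsetU !in_fset1 -!orbA. Qed.

Section ProjectivePoints.
Variables (R : fieldType) (V : vectType R).
Implicit Types (P Q : projSpace V) (X Y : {fset projSpace V}).

Lemma line_of_mem P (v : V) :
  v \in point_space P -> v != 0 -> <[v]>%VS = point_space P.
Proof.
move=> v_P v_neq0; apply/eqP.
by rewrite eqEdim -memvE v_P dim_vline v_neq0 (eqP (valP P)).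
Qed.

Lemma vpick_point_neq0 P : vpick P != 0.
Proof. by rewrite vpick0 -dimv_eq0 (eqP (valP P)). Qed.

Lemma line_vpick P : <[vpick P]>%VS = point_space P.
Proof. by rewrite (line_of_mem (memv_pick _)) // vpick_point_neq0. Qed.

Lemma free_point2 P Q : P != Q -> free [:: vpick P; vpick Q].
Proof.
rewrite -(inj_eq val_inj) => P_Q.
rewrite free_cons span_seq1 seq1_free vpick_point_neq0 andbT line_vpick.
apply: contra P_Q => vP_Q.
by rewrite -[val P]line_vpick (line_of_mem vP_Q) ?vpick_point_neq0.
Qed.

(** Independence depends only on the dimension of the sum of the lines, so a single choice of
    representatives decides it. *)
Lemma independentP X :
  independent X <-> free [seq vpick (P : {vspace V}) | P : projSpace V <- X].
Proof.
split=> [|X_free x x_X].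
  by apply=> P _; rewrite memv_pick vpick_point_neq0.
move: X_free; rewrite !free_dim !big_map !size_map => /eqP <-; apply/eqP.
congr (\dim _); apply: eq_big_seq => P /x_X[x_P x_neq0].
by rewrite line_vpick (line_of_mem x_P).
Qed.

Lemma extendsToPGL_hom X (s : {perm X}) : extendsToPGL s ->
  exists2 g : 'End(V), lker g == 0%VS &
    forall P : X, (g @: <[vpick (val P)]>)%VS = <[vpick (val (s P))]>%VS.
Proof.
case=> f [g g_bij fE] fs; exists g => [|P].
  by apply/lker0P; apply: bij_inj.
by rewrite !line_vpick -fE fs.
Qed.

Lemma map_val_insub (X : {fset projSpace V}) (s : seq (projSpace V)) :
  {subset s <= X} -> map val (pmap (insub : _ -> option X) s) = s.
Proof.
move=> s_X; rewrite (pmap_filter (insubK _)); apply/all_filterP/allP => P /s_X.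
by rewrite isSome_insub.
Qed.

End ProjectivePoints.

(** * Case distinction by the least size of a dependent subset *)

Theorem theorem2 (R : fieldType) (V : vectType R) (n : nat)
    (dimV : \dim {:V} = n) (n_ge2 : (2 <= n)%N)
    (X : {fset projSpace V}) (X_gt1 : (1 < #|` X|)%N)
    (X_ext : forall s : {perm X}, extendsToPGL s) :
  [\/ independent X,
      exists2 m : nat, (2 <= m <= n)%N & simplex m X
    | 3%N \in [pchar R] /\ harmonic X].
Proof.
pose x (P : X) := vpick (val P).
have x_hom s := extendsToPGL_hom (X_ext s).
have x_neq0 P : x P != 0 by apply: vpick_point_neq0.
have x_free P Q : P != Q -> free [:: x P; x Q].
  by move=> P_Q; apply: free_point2; rewrite (inj_eq val_inj).
(* Subsets of [X] are traded for duplicate-free sequences over the finite type [X], to which the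
   results on homogeneous families apply. *)
have indepE Y : Y `<=` X -> exists s : seq X,
    [/\ uniq s, size s = #|` Y| & independent Y <-> free (map x s)].
  move=> /fsubsetP /map_val_insub; set s := pmap _ _ => sE; exists s; split.
  - by rewrite -(map_inj_uniq val_inj) sE fset_uniq.
  - by rewrite -(size_map val) sE.
  - by rewrite independentP -sE -map_comp.
have cardX : size (enum {: X}) = #|` X| by rewrite -cardE cardfE.
have [X_free|X_dep] := boolP (free (map x (enum {: X}))).
  have [s [s_uniq size_s s_indep]] := indepE X (fsubset_refl X).
  apply: Or31; apply/s_indep; apply: free_uniq_size X_free => //.
    exact: enum_uniq.
  by rewrite size_s cardX.
(* By symmetry, prefixes of one enumeration represent the subsets of every size. *)
have dep_ex : exists k, ~~ free (map x (take k (enum {: X}))).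
  by exists (size (enum {: X})); rewrite take_size.
case: (ex_minnP dep_ex) => k k_dep k_min.
have take_free (s : seq X) : uniq s ->
    free (map x s) = free (map x (take (size s) (enum {: X}))).
  move=> s_uniq; have size_take : size (take (size s) (enum {: X})) = size s.
    by rewrite size_takel // -cardE -(card_uniqP s_uniq) max_card.
  by apply/idP/idP; apply: free_uniq_size; rewrite ?take_uniq ?enum_uniq.
have k_le : (k <= #|` X|)%N by rewrite -cardX k_min // take_size.
have k_gt2 : (2 < k)%N.
  rewrite ltnNge; apply: contraNN k_dep => k_le2.
  have: uniq (take k (enum {: X})) by rewrite take_uniq ?enum_uniq.
  have: (size (take k (enum {: X})) <= 2)%N by rewrite size_takel // cardX.
  case: (take _ _) => [|P [|Q []]] // _.
  - by rewrite nil_free.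
  - by rewrite seq1_free x_neq0.
  - by rewrite cons_uniq inE => /andP[/x_free].
case: k => // m in k_dep k_min k_le k_gt2 *.
have m_free (s : seq X) : uniq s -> size s = m -> free (map x s).
  move=> s_uniq size_s; rewrite take_free // size_s; apply: contraT => /k_min.
  by rewrite ltnn.
have m1_dep (s : seq X) : uniq s -> size s = m.+1 -> ~~ free (map x s).
  by move=> s_uniq size_s; rewrite take_free // size_s.
have [X_eq|X_neq] := eqVneq #|` X| m.+1.
  (* The bound [m <= n] holds because some [m] vectors of [V] are free. *)
  apply: Or32; exists m; first (apply/andP; split=> //).
    have size_take : size (take m (enum {: X})) = m.
      by rewrite size_takel // cardX ltnW.
    have := m_free (take m (enum {: X})).
    rewrite take_uniq ?enum_uniq // => /(_ isT size_take).
    by rewrite /free size_map size_take => /eqP<-; rewrite -dimV dimvS ?subvf.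
  split=> // [X_indep|Y Y_X size_Y].
    have [s [s_uniq size_s s_indep]] := indepE X (fsubset_refl X).
    by have := m1_dep s s_uniq; rewrite size_s s_indep.1 // => /(_ X_eq).
  have [s [s_uniq size_s s_indep]] := indepE Y Y_X.
  by apply/s_indep/m_free; rewrite ?size_s.
have X_gt : (m.+1 < #|{: X}|)%N by rewrite -cardfE ltn_neqAle eq_sym X_neq.
(* At least [m + 2] points remain, which is impossible for [m > 2]. *)
have m2 : m = 2.
  apply/eqP; rewrite eqn_leq (k_gt2 : (2 <= m)%N) andbT leqNgt.
  apply/negP => m_gt2.
  have := no_two_extra_points x_hom x_neq0 m_gt2 m_free m1_dep.
  by rewrite leqNgt X_gt.
rewrite m2 in m1_dep X_gt.
have [char3 [i [j [k [l [u [v [uv_free ijkl_all]]]]]]]] :=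
  harmonic_of_extra_points x_hom x_neq0 x_free m1_dep X_gt.
rewrite /x /= !line_vpick => -[i_u j_v k_uv l_uv].
apply: Or33; split; first by rewrite inE /= char3 eqxx.
exists u, v; split=> //; rewrite -i_u -j_v -k_uv -l_uv.
apply/fsetP => W; apply/imfsetP/idP => [[P P_X ->]|].
  rewrite in_fset4.
  by case: (ijkl_all [` P_X]) => /(congr1 val) /= ->; rewrite eqxx ?orbT.
rewrite in_fset4 => /or4P[] /eqP->;
  [exists (val i) | exists (val j) | exists (val k) | exists (val l)] => //;
  exact: valP.
Qed.
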